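(* Let $(P,\mathcal S)$, $\mathcal S=\{S_1,\dots,S_m\}$, and $(P',\mathcal S')$, $\mathcal S'=\{S_1',\dots,S_m'\}$, be polygonal tree systems associated with convex polygons $P,P'\subset\mathbb R^2$, with attractors $K$ and $K'$. Suppose that the vertices $A_1,\dots,A_n$ of $P$ and $A_1',\dots,A_n'$ of $P'$ satisfy the following conditions: (i) for any $i,j\in\{1,\dots,n\}$ and any $k\in\{1,\dots,m\}$, $S_k(A_i)=A_j$ if and only if $S_k'(A_i')=A_j'$; (ii) for any $i,j\in\{1,\dots,n\}$ and any $k_1,k_2\in\{1,\dots,m\}$, $S_{k_1}(A_i)=S_{k_2}(A_j)$ if and only if $S'_{k_1}(A'_i)=S'_{k_2}(A'_j)$. Then there is a bi-Hölder homeomorphism $\psi:K\to K'$ (i.e. a homeomorphism such that both $\psi$ and $\psi^{-1}$ are Hölder continuous) such that $\psi\circ S_i=S'_i\circ\psi$ on $K$ for every $i=1,\dots,m$.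
   Context: A polygon is understood as a compact region of the plane with nonempty interior. Let $P\subset\mathbb R^2$ be a convex polygon with vertices $A_1,\dots,A_n$, and let $\mathcal S=\{S_1,\dots,S_m\}$ be a finite system of contracting similarities of $\mathbb R^2$ (maps with $|S_i(x)-S_i(y)|=r_i|x-y|$ for all $x,y$, where $0<r_i<1$). Put $P_k=S_k(P)$. The system $(P,\mathcal S)$ is called a polygonal tree system associated with $P$ if: (D1) $P_k\subset P$ for all $k$; (D2) for $i\ne j$, $P_i\cap P_j$ is either empty or consists of exactly one point which is a common vertex of $P_i$ and $P_j$; (D3) for every vertex $A_k$ of $P$ there is an $i$ with $A_k\in P_i$; (D4) the set $\widetilde P=\bigcup_{i=1}^m P_i$ is contractible. The attractor of $\mathcal S$ is the unique nonempty compact set $K\subset\mathbb R^2$ with $K=\bigcup_{i=1}^m S_i(K)$. The enumeration of the vertices of $P$ and $P'$ need not follow any particular (e.g. cyclic) order; arbitrary enumerations are allowed. *)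

(* Defs.v *)
From mathcomp Require Import all_boot all_order all_algebra.
From mathcomp Require Import all_classical all_reals all_analysis.

Set Implicit Arguments.
Unset Strict Implicit.
Unset Printing Implicit Defensive.

Import Order.TTheory GRing.Theory Num.Theory.
Import numFieldNormedType.Exports.

Local Open Scope classical_set_scope.
Local Open Scope ring_scope.

(* The canonical norm on 'rV[R]_2 is the sup norm: it induces the right topology
   but the wrong similarities, hence [edist]. *)
Notation plane R := 'rV[R]_2.

Definition edist (R : realType) (x y : plane R) : R :=
  Num.sqrt (\sum_i (x ord0 i - y ord0 i) ^+ 2).

Definition convex_hull (R : realType) (V : set (plane R)) : set (plane R) :=
  smallest (@convex_set R (plane R)) V.

Definition convex_polygon (R : realType) (P : set (plane R)) : Prop :=
  (exists2 V, finite_set V & P = convex_hull V) /\ P° !=set0.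

(* The vertices of a convex polygon are its extreme points. *)
Definition vertices (R : realType) (P : set (plane R)) : set (plane R) :=
  [set x | P x /\ forall (y z : plane R) (t : R), P y -> P z -> 0 < t < 1 ->
     x = t *: y + (1 - t) *: z -> y = z].

Definition contracting_similarity (R : realType) (f : plane R -> plane R) : Prop :=
  exists2 r : R, 0 < r < 1 & forall x y, edist (f x) (f y) = r * edist x y.

(* [H] is constrained only on `[0, 1] `*` X, with the subspace topology. *)
Definition contractible (R : realType) (X : set (plane R)) : Prop :=
  exists (c : plane R) (H : R * plane R -> plane R),
    [/\ X c,
        {within `[0, 1] `*` X, continuous H},
        forall t x, 0 <= t <= 1 -> X x -> X (H (t, x)),
        forall x, X x -> H (0, x) = x &
        forall x, X x -> H (1, x) = c].

Record polygonal_tree_system (R : realType) (m : nat) (P : set (plane R))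
    (S : 'I_m -> plane R -> plane R) : Prop := PolygonalTreeSystem {
  pts_polygon : convex_polygon P;
  pts_similarity : forall k, contracting_similarity (S k);
  pts_D1 : forall k, S k @` P `<=` P;
  pts_D2 : forall i j, i != j ->
    (S i @` P) `&` (S j @` P) = set0 \/
    exists x, [/\ (S i @` P) `&` (S j @` P) = [set x],
                  vertices (S i @` P) x & vertices (S j @` P) x];
  pts_D3 : forall x, vertices P x -> exists i, (S i @` P) x;
  pts_D4 : contractible (\bigcup_i (S i @` P))
}.

Definition attractor (R : realType) (m : nat)
    (S : 'I_m -> plane R -> plane R) (K : set (plane R)) : Prop :=
  [/\ K !=set0, compact K & K = \bigcup_i (S i @` K)].

Definition holder_on (R : realType) (X : set (plane R))
    (f : plane R -> plane R) : Prop :=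
  exists C alpha : R, [/\ 0 < C, 0 < alpha <= 1 &
    forall x y, X x -> X y -> edist (f x) (f y) <= C * (edist x y) `^ alpha].

(* Maps X -> Y are total functions whose values outside X are irrelevant. *)
Definition bi_holder_homeomorphism (R : realType) (X Y : set (plane R))
    (psi : plane R -> plane R) : Prop :=
  exists phi : plane R -> plane R,
    [/\ [/\ set_fun X Y psi, set_fun Y X phi,
            {in X, cancel psi phi} & {in Y, cancel phi psi}],
        {within X, continuous psi}, {within Y, continuous phi},
        holder_on X psi & holder_on Y phi].

(* Main.v *)
Require Import Defs.
From mathcomp Require Import all_boot all_order all_algebra.
From mathcomp Require Import all_classical all_reals all_analysis.
From mathcomp Require Import ring lra.

Import Order.TTheory GRing.Theory Num.Theory.
Import numFieldNormedType.Exports.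

Local Open Scope classical_set_scope.
Local Open Scope ring_scope.

Set Implicit Arguments.
Unset Strict Implicit.

(** Every point of an attractor is coded by an address: an infinite sequence of
    indices whose nested cylinders shrink to the point. The conjugacy [psi]
    sends the point of [K] with a given address to the point of [K'] with the
    same address. Since prefixing an index to an address corresponds to
    applying [S i] on one side and [S' i] on the other, [psi] intertwines the
    two systems; what needs proof is that it is well defined, injective, and
    Hölder in both directions. All of this is contained in one inequality
    ([same_address_holder]): if [x, x'] share an address and so do [y, y'], then
    [|x' - y'| <= C |x - y| ^ alpha]. Taking [x = y] shows that [psi] is well
    defined, and exchanging the two systems, which satisfy symmetric
    hypotheses, gives the inverse map.

    The exponent is chosen so that [r' i <= r i ^ alpha] for the ratios of all
    the maps ([holder_exponent]). Then the inequality for two points implies the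
    inequality, with the same [C], for their images under [S i] and [S' i]
    ([holder_step]). As common initial indices can thus be removed, only points
    [x = S i z], [y = S j w] in different pieces matter.

    - If the pieces are disjoint, [|x - y|] is bounded below and there is nothing
      to do.
    - If they meet in a common vertex [v], the two polygons diverge linearly from
      [v]: [|x - y| >= c |x - v|] and [|x - y| >= c |y - v|]
      ([piece_separation]). By the second condition on the vertices, the
      corresponding pieces of the other system share the corresponding vertex
      [v'], so the triangle inequality through [v'] reduces the claim to pairs
      consisting of a point and a vertex.

    For a point [z] and a vertex [A a] ([vertex_estimate]), either the piece
    containing [z] misses [A a], and the distance is bounded below, or
    [A a = S i (A b)]; then the first condition gives [A' a = S' i (A' b)] and
    [S i] can be removed again.

    Removing indices need not end. Both estimates are therefore proved up to an
    error [D rho ^ N] by induction on [N], with [rho < 1] bounding the ratios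
    [r'], and [N] is sent to infinity ([le_of_geometric]).

    Linear divergence rests on the description of a polygon as a cone: if [v] is
    a vertex of [P], then [P] is the union of the segments from [v] to a compact
    base avoiding [v] ([polygon_cone]). Two such cones meeting only at [v] have
    each base at positive distance from the other cone, and homothety turns this
    into a linear bound ([cone_separation]). *)

(* The real-valued Euclidean distance, as opposed to the extended-real distance
   of a pseudometric space. *)
Local Notation edist := Defs.edist.

(** * The Euclidean distance of the plane *)

Section EuclideanDistance.
Context {R : realType}.
Implicit Types (x y z v w b : plane R) (t : R).

Lemma edistE x y : edist x y =
  Num.sqrt ((x ord0 ord0 - y ord0 ord0) ^+ 2 +
            (x ord0 ord_max - y ord0 ord_max) ^+ 2).
Proof.
rewrite /edist big_ord_recl big_ord1 (_ : lift ord0 ord0 = ord_max)//.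
exact/val_inj.
Qed.

Lemma sqr_edist x y : edist x y ^+ 2 =
  (x ord0 ord0 - y ord0 ord0) ^+ 2 + (x ord0 ord_max - y ord0 ord_max) ^+ 2.
Proof. by rewrite edistE sqr_sqrtr// addr_ge0// sqr_ge0. Qed.

Lemma edist_ge0 x y : 0 <= edist x y.
Proof. exact: sqrtr_ge0. Qed.

Lemma edistC x y : edist x y = edist y x.
Proof. by rewrite !edistE; congr (Num.sqrt (_ + _)); ring. Qed.

Lemma edistxx x : edist x x = 0.
Proof. by rewrite edistE !subrr expr0n addr0 sqrtr0. Qed.

Lemma edist_eq0 x y : edist x y = 0 -> x = y.
Proof.
move=> d0; have := sqr_edist x y; rewrite d0 expr0n => /esym/eqP.
rewrite paddr_eq0 ?sqr_ge0// !sqrf_eq0 !subr_eq0 => /andP[/eqP e0 /eqP e1].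
apply/rowP => -[[|[|//]] i].
- by rewrite (_ : Ordinal i = ord0) //; exact/val_inj.
- by rewrite (_ : Ordinal i = ord_max) //; exact/val_inj.
Qed.

Lemma edist_triangle x y z : edist x z <= edist x y + edist y z.
Proof.
rewrite -(@ler_pXn2r _ 2) ?nnegrE ?addr_ge0 ?edist_ge0//.
rewrite sqrrD !sqr_edist.
set a := x ord0 ord0; set b := y ord0 ord0; set c := z ord0 ord0.
set a' := x ord0 ord_max; set b' := y ord0 ord_max; set c' := z ord0 ord_max.
suff : (a - b) * (b - c) + (a' - b') * (b' - c') <= edist x y * edist y z by nra.
apply: le_trans (ler_norm _) _.
rewrite -(@ler_pXn2r _ 2) ?nnegrE ?normr_ge0 ?mulr_ge0 ?edist_ge0//.
rewrite exprMn !sqr_edist -/a -/b -/c -/a' -/b' -/c' real_normK ?num_real//.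
have := sqr_ge0 ((a - b) * (b' - c') - (a' - b') * (b - c)).
nra.
Qed.

Lemma coord_sub_le_edist x y i : `|x ord0 i - y ord0 i| <= edist x y.
Proof.
rewrite -(@ler_pXn2r _ 2) ?nnegrE ?normr_ge0 ?edist_ge0//.
rewrite real_normK ?num_real// sqr_edist.
case: i => -[|[|//]] i.
- by rewrite (_ : Ordinal i = ord0) ?lerDl ?sqr_ge0//; exact/val_inj.
- by rewrite (_ : Ordinal i = ord_max) ?lerDr ?sqr_ge0//; exact/val_inj.
Qed.

Lemma edist_homothety t v x y :
  edist (t *: x + (1 - t) *: v) (t *: y + (1 - t) *: v) = `|t| * edist x y.
Proof.
rewrite !edistE !mxE -sqrtr_sqr -sqrtrM ?sqr_ge0//; congr Num.sqrt; ring.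
Qed.

Lemma combination_diag t v : t *: v + (1 - t) *: v = v.
Proof. by rewrite -scalerDl addrC subrK scale1r. Qed.

Lemma edist_segment t v x : 0 <= t ->
  edist (t *: x + (1 - t) *: v) v = t * edist x v.
Proof.
move=> t0; have := edist_homothety t v x v.
by rewrite combination_diag ger0_norm.
Qed.

(** Stewart's identity: it expresses affine combinations in terms of distances
    alone, so that maps scaling distances preserve them. *)
Lemma sqr_edist_combination t x y w :
  edist (t *: x + (1 - t) *: y) w ^+ 2 =
  t * edist x w ^+ 2 + (1 - t) * edist y w ^+ 2 - t * (1 - t) * edist x y ^+ 2.
Proof. by rewrite !sqr_edist !mxE; ring. Qed.

Lemma continuous_edist : continuous (fun p : plane R * plane R => edist p.1 p.2).
Proof.
pose q (p : plane R * plane R) i := (p.1 ord0 i - p.2 ord0 i) ^+ 2.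
have -> : (fun p : plane R * plane R => edist p.1 p.2) =
    Num.sqrt \o (fun p => q p ord0 + q p ord_max).
  by apply/funext => p; rewrite edistE.
have cq i : continuous (q^~ i).
  move=> p.
  have cp : (fun p : plane R * plane R => p.1 ord0 i - p.2 ord0 i) @ p -->
      p.1 ord0 i - p.2 ord0 i.
    apply: cvgB.
    - apply: (@continuous_comp _ _ _ fst (fun x : plane R => x ord0 i) p).
        exact: cvg_fst.
      exact: coord_continuous.
    - apply: (@continuous_comp _ _ _ snd (fun x : plane R => x ord0 i) p).
        exact: cvg_snd.
      exact: coord_continuous.
  exact: (@continuous_comp _ _ _ _ (fun u : R => u ^+ 2) p cp
    (@exprn_continuous _ 2 _)).
move=> p; apply: continuous_comp; last exact: sqrt_continuous.
exact: cvgD (cq ord0 p) (cq ord_max p).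
Qed.

Lemma bounded_edist (B C : set (plane R)) : compact B -> compact C ->
  exists2 D, 0 < D & forall x y, B x -> C y -> edist x y <= D.
Proof.
move=> cB cC; have [[p [Bp Cp]]|BC0] := pselect ((B `*` C) !=set0); last first.
  by exists 1 => // x y Bx Cy; case: BC0; exists (x, y).
have [q _ qmax] := compact_EVT_max (ex_intro (B `*` C) p (conj Bp Cp))
  (compact_setX cB cC) (continuous_subspaceT continuous_edist).
exists (1 + edist q.1 q.2) => [|x y Bx Cy]; first by rewrite ltr_wpDr ?edist_ge0.
by apply: ler_wpDl => //; apply: (qmax (x, y)); rewrite inE.
Qed.

Lemma separated_compact (B C : set (plane R)) : compact B -> compact C ->
  B `&` C = set0 ->
  exists2 d, 0 < d & forall x y, B x -> C y -> d <= edist x y.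
Proof.
move=> cB cC BC; have [[p [Bp Cp]]|BC0] := pselect ((B `*` C) !=set0); last first.
  by exists 1 => // x y Bx Cy; case: BC0; exists (x, y).
have [q qBC qmin] := compact_EVT_min (ex_intro (B `*` C) p (conj Bp Cp))
  (compact_setX cB cC) (continuous_subspaceT continuous_edist).
exists (edist q.1 q.2) => [|x y Bx Cy]; last first.
  by apply: (qmin (x, y)); rewrite inE.
rewrite lt_neqAle edist_ge0 andbT; apply/eqP => /esym/edist_eq0 q12.
move: qBC; rewrite inE => -[Bq Cq].
suff : (B `&` C) q.1 by rewrite BC.
by split => //; rewrite q12.
Qed.

(** Together with [near_edist], this says that [edist] induces the topology of
    the plane, which is defined by the sup norm. *)
Lemma edist_lt_near x (e : R) : 0 < e -> \forall y \near x, edist x y < e.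
Proof.
move=> e0.
have cx : (fun y => edist x y) @ x --> edist x x.
  apply: (@continuous_comp _ _ _ (fun y => (x, y))
    (fun p : plane R * plane R => edist p.1 p.2) x); last exact: continuous_edist.
  exact: (@cvg_pair _ _ _ (nbhs x) (nbhs x) (nbhs x) _ _ _ (cst x) id
    (cvg_cst x) cvg_id).
by have := cvgr_lt _ cx e; rewrite edistxx; apply.
Qed.

Lemma near_edist x (U : set (plane R)) : nbhs x U ->
  exists2 e : R, 0 < e & forall y, edist x y < e -> U y.
Proof.
move=> /nbhs_ballP[e e0 eU]; exists e => // y xy; apply: eU.
split=> // i j; rewrite /ball /= (ord1 i).
exact: le_lt_trans (coord_sub_le_edist _ _ _) xy.
Qed.

End EuclideanDistance.

(** * Convex polygons as cones over a compact base *)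

Section Cones.
Context {R : realType}.
Implicit Types (x y v w b : plane R) (t : R) (B P : set (plane R)).

(** The apex is added by hand so that the cone over the empty set is [v]; this
    makes [hull] below correct on singletons. *)
Definition cone_over v B : set (plane R) :=
  [set x | x = v \/
    exists t b, [/\ 0 <= t <= 1, B b & x = t *: b + (1 - t) *: v]].

Lemma apex_cone v B : cone_over v B v.
Proof. by left. Qed.

Lemma sub_cone v B : B `<=` cone_over v B.
Proof.
move=> b Bb; right; exists 1, b; split => //; first by rewrite ler01 lexx.
by rewrite subrr scale0r scale1r addr0.
Qed.

Lemma cone_segment v B x t : 0 <= t <= 1 -> cone_over v B x ->
  cone_over v B (t *: x + (1 - t) *: v).
Proof.
move=> t01 [->|[s [b [s01 Bb ->]]]].
  by left; rewrite combination_diag.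
right; exists (t * s), b; split => //; first by apply/andP; nra.
by apply/rowP => i; rewrite !mxE; ring.
Qed.

Lemma compact_cone v B : compact B -> compact (cone_over v B).
Proof.
move=> cB; have -> : cone_over v B = [set v] `|`
    (fun p : R * plane R => p.1 *: p.2 + (1 - p.1) *: v) @` (`[0, 1] `*` B).
  apply/seteqP; split=> [x [->|[t [b [t01 Bb ->]]]]|x [->|[[t b] [/= t01 Bb] <-]]].
  - by left.
  - by right; exists (t, b) => //=; split => //=; rewrite in_itv.
  - by left.
  - by right; exists t, b; split => //; move: t01; rewrite in_itv.
apply: compactU; first exact: compact_set1.
apply: continuous_compact; last exact: compact_setX (@segment_compact _ _ _) cB.
apply: continuous_subspaceT => p.
apply: cvgD; apply: cvgZ; [exact: cvg_fst|exact: cvg_snd| |exact: cvg_cst].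
by apply: cvgB; [exact: cvg_cst|exact: cvg_fst].
Qed.

(** Convexity with a real parameter, in place of a point of the unit interval
    type. *)
Definition convex_subset B := forall x y t, 0 <= t <= 1 -> B x -> B y ->
  B (t *: x + (1 - t) *: y).

Lemma convex_subsetE B : convex_set B <-> convex_subset B.
Proof.
split=> [cB x y t t01 Bx By|cB x y t].
- have [t0 t1] := andP t01.
  by have := cB x y (Itv01 t0 t1); rewrite !inE; exact.
- by rewrite !inE => Bx By; apply: cB => //; rewrite ge0 le1.
Qed.

(** A combination of [v + p (b - v)] and [v + q (c - v)] is [v + u (d - v)],
    where [u] is the same combination of [p] and [q], and [d] is the mean of [b]
    and [c] with weights [t p] and [(1 - t) q]. *)
Lemma convex_cone v B : convex_subset B -> convex_subset (cone_over v B).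
Proof.
move=> cB x y t t01 [->|[p [b [p01 Bb ->]]]] [->|[q [c [q01 Bc ->]]]].
- by left; rewrite combination_diag.
- rewrite addrC -{2}(subKr 1 t); apply: cone_segment; first lra.
  by right; exists q, c.
- by apply: cone_segment => //; right; exists p, b.
- have [u0|u0] := eqVneq (t * p + (1 - t) * q) 0.
    have tp : t * p = 0 by nra.
    have tq : (1 - t) * q = 0 by nra.
    left; apply/rowP => i; rewrite !mxE.
    transitivity (v ord0 i + t * p * (b ord0 i - v ord0 i) +
                 (1 - t) * q * (c ord0 i - v ord0 i)); first by ring.
    by rewrite tp tq; ring.
  right; exists (t * p + (1 - t) * q),
    ((t * p / (t * p + (1 - t) * q)) *: b +
     (1 - t * p / (t * p + (1 - t) * q)) *: c); split.
  + by apply/andP; nra.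
  + apply: cB => //; apply/andP; split.
      by apply: divr_ge0; nra.
    by rewrite ler_pdivrMr ?mul1r ?lt_neqAle ?[0 == _]eq_sym ?u0 /=; nra.
  + by apply/rowP => i; rewrite !mxE; field.
Qed.

(** If [x = v + s (b - v)] and [y] lies at most as far along its own ray
    ([t <= s]), then dividing by [s] puts [x] at [b] and keeps [y] inside its
    cone, where [b] and the cone are at positive distance. *)
Lemma cone_separation v B C : compact B -> compact C -> ~ B v -> ~ C v ->
  cone_over v B `&` cone_over v C = [set v] ->
  exists2 c, 0 < c & forall x y, cone_over v B x -> cone_over v C y ->
    c * edist x v <= edist x y.
Proof.
move=> cB cC Bv Cv BCv.
(* A common point of a base and the other cone could only be [v]. *)
have disj (E F : set (plane R)) : compact E -> compact F -> ~ E v ->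
    cone_over v E `&` cone_over v F = [set v] ->
    exists2 d, 0 < d & forall x y, E x -> cone_over v F y -> d <= edist x y.
  move=> cE cF Ev EFv; apply: separated_compact => //; first exact: compact_cone.
  rewrite -subset0 => x [Ex Fx]; apply: Ev.
  suff <- : x = v by [].
  suff : [set v] x by [].
  by rewrite -EFv; split => //; exact: sub_cone.
(* Division by the larger parameter [s]. *)
have scale (E F : set (plane R)) d :
    (forall x y, E x -> cone_over v F y -> d <= edist x y) ->
    forall s t b y, 0 < s -> 0 <= t <= s -> E b -> F y ->
    s * d <= edist (s *: b + (1 - s) *: v) (t *: y + (1 - t) *: v).
  move=> dP s t b y s0 /andP[t0 ts] Eb Fy.
  have -> : t *: y + (1 - t) *: v =
      s *: ((t / s) *: y + (1 - t / s) *: v) + (1 - s) *: v.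
    by apply/rowP => i; rewrite !mxE; field; rewrite gt_eqF.
  rewrite edist_homothety gtr0_norm// ler_pM2l//; apply: dP => //.
  apply: cone_segment; last exact: sub_cone.
  by rewrite divr_ge0 ?(ltW s0)//= ler_pdivrMr// mul1r.
have [d d0 dP] := disj _ _ cB cC Bv BCv.
have CBv : cone_over v C `&` cone_over v B = [set v] by rewrite setIC.
have [e e0 eP] := disj _ _ cC cB Cv CBv.
have [D D0 DP] := bounded_edist cB (compact_set1 (x := v)).
have mn0 : 0 < Num.min d e by rewrite lt_min d0 e0.
exists (Num.min d e / D) => [|x w]; first exact: divr_gt0.
have key s t b z : 0 <= s -> 0 <= t -> B b -> C z ->
    Num.min d e * s <= edist (s *: b + (1 - s) *: v) (t *: z + (1 - t) *: v).
  move=> s0 t0 Bb Cz; have [st|ts] := ltP s t.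
    rewrite edistC (@le_trans _ _ (t * e))//; last first.
      by apply: (scale C B) => //; [exact: le_lt_trans st|rewrite s0 ltW].
    by rewrite mulrC ler_pM ?(ltW mn0)// ?(ltW st)// ge_min lexx orbT.
  have [->|sn0] := eqVneq s 0; first by rewrite mulr0 edist_ge0.
  apply: (@le_trans _ _ (s * d)).
    by rewrite mulrC ler_wpM2l// ge_min lexx.
  by apply: (scale B C) => //; rewrite ?lt_neqAle ?[0 == _]eq_sym ?sn0 ?t0.
case=> [->|[s [b [/andP[s0 s1] Bb ->]]]] Cw.
  by rewrite edistxx mulr0 edist_ge0.
rewrite edist_segment//.
apply: (@le_trans _ _ (Num.min d e * s)).
  rewrite -mulrA ler_pM2l// mulrCA ler_piMr// mulrC ler_pdivrMr// mul1r.
  exact: DP.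
(* The apex of the second cone need not lie on a ray, its base may be empty. *)
case: Cw => [->|[t [c [/andP[t0 t1] Cc ->]]]]; last exact: key.
have [->|sn0] := eqVneq s 0; first by rewrite mulr0 edist_ge0.
have s_gt0 : 0 < s by rewrite lt_neqAle eq_sym sn0.
have dv : d <= edist b v by apply: dP => //; left.
rewrite edist_segment//.
by rewrite mulrC ler_pM2l//; apply: le_trans dv; rewrite ge_min lexx.
Qed.

Definition affine_map (f : plane R -> plane R) := forall x y t,
  f (t *: x + (1 - t) *: y) = t *: f x + (1 - t) *: f y.

Lemma image_cone f v B : affine_map f ->
  f @` cone_over v B = cone_over (f v) (f @` B).
Proof.
move=> af; apply/seteqP; split => [_ [x [->|[t [b [t01 Bb ->]]]] <-]|x].
- by left.
- by right; exists t, (f b); split => //; exists b.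
- case=> [->|[t [_ [t01 [b Bb <-]] ->]]]; first by exists v => //; left.
  by exists (t *: b + (1 - t) *: v); rewrite ?af//; right; exists t, b.
Qed.

(** Adding the generators one at a time makes compactness and convexity of the
    hull immediate inductions. *)
Definition hull (s : seq (plane R)) : set (plane R) := foldr cone_over set0 s.

Lemma compact_hull s : compact (hull s).
Proof. by elim: s => [|a s IH]; [exact: compact0|exact: compact_cone]. Qed.

Lemma convex_subset_hull s : convex_subset (hull s).
Proof. by elim: s => [|a s IH]; [move=> ?|exact: convex_cone]. Qed.

Lemma sub_hull s : [set` s] `<=` hull s.
Proof.
elim: s => [|a s IH] x //=; rewrite inE => /orP[/eqP->|xs]; first by left.
exact/sub_cone/IH.
Qed.

Lemma hull_sub s B : convex_subset B -> [set` s] `<=` B -> hull s `<=` B.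
Proof.
move=> cB; elim: s => [|a s IH] sB //= x [->|[t [b [t01 hb ->]]]].
  by apply: sB; rewrite /= mem_head.
apply: cB => //; last by apply: sB; rewrite /= mem_head.
by apply: IH hb => y ys; apply: sB; rewrite /= inE ys orbT.
Qed.

Lemma convex_hullE s : convex_hull [set` s] = hull s.
Proof.
apply/seteqP; split.
- apply: smallest_sub; last exact: sub_hull.
  exact/convex_subsetE/convex_subset_hull.
- move=> x hx B [/convex_subsetE cB sB]; exact: hull_sub hx.
Qed.

(** A point of the cone that is neither the apex nor in the base is interior to
    a segment, hence not extreme. *)
Lemma extreme_hull (Q : set (plane R)) s v : hull s `<=` Q -> vertices Q v ->
  hull s v -> v \in s.
Proof.
move=> + [_ vext]; elim: s => [//|a s IH] sQ /=.
have hsQ : hull s `<=` Q by move=> x hx; apply/sQ/sub_cone.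
case=> [->|[t [b [/andP[t0 t1] hb vE]]]]; first exact: mem_head.
rewrite inE; apply/orP.
have [t00|tn0] := eqVneq t 0.
  by left; rewrite vE t00 scale0r add0r subr0 scale1r.
have [t11|tn1] := eqVneq t 1.
  by right; apply: IH => //; rewrite vE t11 subrr scale0r addr0 scale1r.
left; have ba : b = a.
  apply: (vext _ _ t) => //; [exact: hsQ|exact/sQ/apex_cone|].
  by rewrite !lt_neqAle t0 t1 tn1 eq_sym tn0.
by rewrite vE ba combination_diag.
Qed.

Lemma compact_polygon P : convex_polygon P -> compact P.
Proof.
by move=> [[V /finite_seqP[s ->] ->] _]; rewrite convex_hullE; exact: compact_hull.
Qed.

(** The base is the hull of the other generators; extremality of [v] keeps [v]
    out of it. *)
Lemma polygon_cone P v : convex_polygon P -> vertices P v ->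
  exists B, [/\ compact B, ~ B v & P = cone_over v B].
Proof.
move=> [[V /finite_seqP[s ->] ->] _]; rewrite convex_hullE => vP.
pose s' := [seq x <- s | x != v]; exists (hull s').
have s'P : hull s' `<=` hull s.
  apply: hull_sub; first exact: convex_subset_hull.
  by move=> x; rewrite /= mem_filter => /andP[_ xs]; exact: sub_hull.
split; first exact: compact_hull.
- by move=> /(extreme_hull s'P vP); rewrite mem_filter /= eqxx.
- apply/seteqP; split.
  + apply: hull_sub; first exact/convex_cone/convex_subset_hull.
    move=> x xs; have [->|xv] := eqVneq x v; first by left.
    by apply/sub_cone/sub_hull; rewrite /= mem_filter /= xv.
  + apply: (@hull_sub (v :: s')); first exact: convex_subset_hull.
    move=> x; rewrite /= inE => /orP[/eqP->|]; first by case: vP.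
    by rewrite mem_filter => /andP[_ xs]; exact: sub_hull.
Qed.

End Cones.

(** * Similarities *)

Section Similarities.
Context {R : realType}.
Implicit Types (x y p : plane R) (r : R) (f : plane R -> plane R).

Definition similarity r f := forall x y, edist (f x) (f y) = r * edist x y.

(** By Stewart's identity, the image of a point of a segment and the
    corresponding point of the image segment are at distance zero. *)
Lemma similarity_affine r f : similarity r f -> affine_map f.
Proof.
move=> sf x y t; apply/esym/edist_eq0/eqP; rewrite -sqrf_eq0; apply/eqP.
rewrite sqr_edist_combination !sf !exprMn.
set z := t *: x + _.
have := sqr_edist_combination t x y z; rewrite edistxx expr0n /= => e.
transitivity (r ^+ 2 * (t * edist x z ^+ 2 + (1 - t) * edist y z ^+ 2 -
    t * (1 - t) * edist x y ^+ 2)); first by ring.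
by rewrite -e mulr0.
Qed.

Lemma similarity_inj r f : 0 < r -> similarity r f -> injective f.
Proof.
move=> r0 sf x y fxy; apply: edist_eq0; apply/eqP.
by have /eqP := sf x y; rewrite fxy edistxx eq_sym mulf_eq0 gt_eqF.
Qed.

Lemma continuous_similarity r f : 0 < r -> similarity r f -> continuous f.
Proof.
move=> r0 sf x U /near_edist[e e0 eU].
have : \forall y \near x, edist x y < e / r by exact/edist_lt_near/divr_gt0.
apply: filterS => y; rewrite ltr_pdivlMr// mulrC => xy.
by apply: eU; rewrite sf.
Qed.

Lemma compact_similarity r f (B : set (plane R)) : 0 < r -> similarity r f ->
  compact B -> compact (f @` B).
Proof.
move=> r0 sf; apply: continuous_compact; apply: continuous_subspaceT.
exact: continuous_similarity r0 sf.
Qed.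

Lemma vertex_preimage f (P Q : set (plane R)) p : affine_map f -> injective f ->
  f @` P `<=` Q -> P p -> vertices Q (f p) -> vertices P p.
Proof.
move=> af fi fPQ Pp [_ ext]; split => // y z t Py Pz t01 pE.
apply: fi; apply: (ext _ _ t) => //; [exact/fPQ/imageP|exact/fPQ/imageP|].
by rewrite pE af.
Qed.

End Similarities.

(** * Uniform constants *)

Section Uniformity.
Context {R : realType}.

(** Constants that may be decreased can be chosen independently of a finite
    index: take the minimum. *)
Lemma finite_uniform (I : finType) (Q : I -> R -> Prop) :
  (forall i, exists2 d, 0 < d & Q i d) ->
  (forall i d e, 0 < e -> e <= d -> Q i d -> Q i e) ->
  exists2 d, 0 < d & forall i, Q i d.
Proof.
move=> exQ monQ.
suff [d d0 dP] : exists2 d, 0 < d & forall i, i \in enum I -> Q i d.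
  by exists d => // i; apply: dP; rewrite mem_enum.
elim: (enum I) => [|i s [d d0 dP]]; first by exists 1.
have [e e0 eQ] := exQ i.
have m0 : 0 < Num.min d e by rewrite lt_min d0 e0.
exists (Num.min d e) => // j; rewrite inE => /orP[/eqP->|js].
- by apply: monQ eQ => //; rewrite ge_min lexx orbT.
- by apply: monQ (dP _ js) => //; rewrite ge_min lexx.
Qed.

(** For a single index, [r' = r ^ (ln r' / ln r)]; as [r < 1], smaller exponents
    only increase [r ^ alpha]. *)
Lemma holder_exponent (I : finType) (r r' : I -> R) :
  (forall i, 0 < r i < 1) -> (forall i, 0 < r' i < 1) ->
  exists2 alpha, 0 < alpha <= 1 & forall i, r' i <= r i `^ alpha.
Proof.
move=> r01 r'01.
have antitone i d e : e <= d -> r' i <= r i `^ d -> r' i <= r i `^ e.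
  have /andP[r0 r1] := r01 i.
  by move=> ed rd; apply: (le_trans rd); apply: ger_powR => //; rewrite r0 ltW.
have [|i d e _|a a0 aP] := @finite_uniform I (fun i a => r' i <= r i `^ a).
- move=> i; have /andP[r0 r1] := r01 i; have /andP[r'0 r'1] := r'01 i.
  have lr : ln (r i) < 0 by rewrite ln_lt0// r0.
  have lr' : ln (r' i) < 0 by rewrite ln_lt0// r'0.
  exists (ln (r' i) / ln (r i)); first by rewrite nmulr_lgt0 ?invr_lt0.
  rewrite le_eqVlt; apply/orP; left; apply/eqP.
  by apply: ln_inj; rewrite ?posrE ?powR_gt0// ln_powR divfK// lt_eqF.
- exact: antitone.
exists (Num.min 1 a) => [|i]; first by rewrite lt_min ltr01 a0 ge_min lexx.
by apply: antitone (aP i); rewrite ge_min lexx orbT.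
Qed.

(** This replaces infinite descent along an address by induction on the depth. *)
Lemma le_of_geometric (u v D rho : R) : 0 <= rho < 1 ->
  (forall N, u <= v + D * rho ^+ N) -> u <= v.
Proof.
move=> /andP[rho0 rho1] uv.
have : (fun N => v + D * rho ^+ N) @ \oo --> v + D * 0.
  apply: cvgD; first exact: cvg_cst.
  apply: cvgM; first exact: cvg_cst.
  by apply: cvg_expr; rewrite ger0_norm.
rewrite mulr0 addr0 => h; apply: (cvgr_to_ge h).
by apply: nearW => N; exact: uv.
Qed.

End Uniformity.

(** * Addresses of points of an attractor *)

Section Addresses.
Context {R : realType} {m : nat}.
Implicit Types (S : 'I_m -> plane R -> plane R) (K P : set (plane R)).
Implicit Types (s : nat -> 'I_m) (x y : plane R).

(** The piece of order [n] of the attractor along the address [s]. The outermost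
    map is the first index, so that the shift of addresses removes it. *)
Fixpoint cylinder S K s n : set (plane R) :=
  if n is n'.+1 then S (s 0%N) @` cylinder S K (fun k => s k.+1) n' else K.

(** The graph of the conjugacy, before it is known to be a graph. *)
Definition same_address S S' K K' x x' :=
  exists s, forall n, cylinder S K s n x /\ cylinder S' K' s n x'.

Lemma attractor_piece S K i x : attractor S K -> K x -> K (S i x).
Proof. by move=> [_ _ KE] Kx; rewrite KE; exists i => //; exists x. Qed.

Lemma sub_cylinder S K s n : attractor S K ->
  cylinder S K s n.+1 `<=` cylinder S K s n.
Proof.
move=> SK; elim: n s => [|n IH] s.
  by move=> _ [x Kx <-]; exact: attractor_piece.
by apply: image_subset; exact: IH.
Qed.

Lemma sub_cylinder_le S K s n k : attractor S K -> (n <= k)%N ->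
  cylinder S K s k `<=` cylinder S K s n.
Proof.
move=> SK /subnK <-; elim: (k - n)%N => [//|d IH] x.
by rewrite addSn => /(sub_cylinder SK)/IH.
Qed.

Lemma cylinder_nonempty S K s n : K !=set0 -> cylinder S K s n !=set0.
Proof.
move=> K0; elim: n s => [//|n IH] s /=.
by have [x Kx] := IH (fun k => s k.+1); exists (S (s 0%N) x), x.
Qed.

Lemma closed_cylinder S K s n : (forall i, continuous (S i)) -> compact K ->
  closed (cylinder S K s n).
Proof.
move=> cS cK; apply: compact_closed; first exact: norm_hausdorff.
elim: n s => [//|n IH] s /=.
by apply: continuous_compact; [exact: continuous_subspaceT|exact: IH].
Qed.

(** The cylinders are nested nonempty compact sets. *)
Lemma address_point S K s : (forall i, continuous (S i)) -> attractor S K ->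
  exists x, forall n, cylinder S K s n x.
Proof.
move=> cS SK; have [K0 cK _] := SK.
pose F := [set B | exists n, cylinder S K s n `<=` B].
have FF : ProperFilter F.
  split; first by move=> [n n0]; have [x /n0] := cylinder_nonempty S s n K0.
  split; first by exists 0%N.
  - move=> B C [n nB] [k kC]; exists (maxn n k) => x Kx; split.
    + exact/nB/(sub_cylinder_le SK (leq_maxl n k) Kx).
    + exact/kC/(sub_cylinder_le SK (leq_maxr n k) Kx).
  - by move=> B C BC [n nB]; exists n; exact: subset_trans BC.
have [|x [_ xF]] := cK F FF; first by exists 0%N.
exists x => n; apply: (closed_cylinder cS cK) => U xU.
by apply: xF => //; exists n.
Qed.

(** Iterate a choice of a piece containing the point. *)
Lemma point_address S K x : attractor S K -> K x ->
  exists s, forall n, cylinder S K s n x.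
Proof.
move=> [_ _ KE] Kx.
(* [y] outside [K] only needs some value, for which an index must exist. *)
have step y : exists p : 'I_m * plane R, K y -> K p.2 /\ y = S p.1 p.2.
  have [Ky|nKy] := pselect (K y).
    by move: (Ky); rewrite {1}KE => -[i _ [z Kz <-]]; exists (i, z).
  by move: Kx; rewrite {1}KE => -[i _ _]; exists (i, y) => /nKy.
have [f fP] := choice step.
pose w n := iter n (fun y => (f y).2) x.
have Kw n : K (w n) by elim: n => [//|n IH] /=; have [] := fP _ IH.
have wE n : w n = S (f (w n)).1 (w n.+1) by have [] := fP _ (Kw n).
exists (fun n => (f (w n)).1) => n.
suff h k : cylinder S K (fun j => (f (w (k + j)%N)).1) n (w k) by exact: (h 0%N).
elim: n k => [|n IH] k /=; first exact: Kw.
exists (w k.+1); last by rewrite addn0 -wE.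
rewrite (_ : (fun j => _) = (fun j => (f (w (k.+1 + j)%N)).1)); first exact: IH.
by apply/funext => j; rewrite addSnnS.
Qed.

Lemma same_address_attractor S S' K K' x x' :
  same_address S S' K K' x x' -> K x /\ K' x'.
Proof. by move=> [s /(_ 0%N)]. Qed.

Lemma same_addressC S S' K K' x x' :
  same_address S S' K K' x x' -> same_address S' S K' K x' x.
Proof. by move=> [s sP]; exists s => n; have [] := sP n. Qed.

Lemma same_address_total S S' K K' x : (forall i, continuous (S' i)) ->
  attractor S K -> attractor S' K' -> K x ->
  exists x', same_address S S' K K' x x'.
Proof.
move=> cS' SK SK' Kx; have [s sP] := point_address SK Kx.
by have [x' x'P] := address_point s cS' SK'; exists x', s => n.
Qed.

Lemma same_address_cons S S' K K' i x x' :
  attractor S K -> attractor S' K' -> same_address S S' K K' x x' ->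
  same_address S S' K K' (S i x) (S' i x').
Proof.
move=> SK SK' [s sP]; exists (fun n => if n is n'.+1 then s n' else i) => -[|n] /=.
  have [Kx Kx'] := sP 0%N.
  by split; [exact: attractor_piece SK Kx|exact: attractor_piece SK' Kx'].
by have [xn x'n] := sP n; split; [exists x|exists x'].
Qed.

(** Injectivity of the maps makes the preimage under the first map of the
    address the same for all cylinders. *)
Lemma same_address_uncons S S' K K' x x' :
  (forall i, injective (S i)) -> (forall i, injective (S' i)) ->
  same_address S S' K K' x x' ->
  exists i y y', [/\ x = S i y, x' = S' i y' & same_address S S' K K' y y'].
Proof.
move=> iS iS' [s sP].
have [[y Ky yx] [y' Ky' yx']] := sP 1%N.
exists (s 0%N), y, y'; split => //; exists (fun k => s k.+1) => n.
have [[z Kz zx] [z' Kz' zx']] := sP n.+1.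
have zy : z = y by apply: (iS (s 0%N)); rewrite zx yx.
have zy' : z' = y' by apply: (iS' (s 0%N)); rewrite zx' yx'.
by rewrite -zy -zy'.
Qed.

(** A point of [K] at depth [N] is within [D rho ^ N] of a point of [P], and
    [P] is closed. *)
Lemma attractor_sub S K P (r : 'I_m -> R) (rho : R) :
  (forall i, similarity (r i) (S i)) -> (forall i, 0 <= r i <= rho) ->
  rho < 1 -> (forall i, S i @` P `<=` P) -> P !=set0 -> compact P ->
  attractor S K -> K `<=` P.
Proof.
move=> simS r01 rho1 SP [p0 Pp0] cP [[x0 Kx0] cK KE] x Kx.
have rho01 : 0 <= rho < 1.
  rewrite rho1 andbT; move: Kx0; rewrite KE => -[i _ _].
  by have /andP[+ +] := r01 i; exact: le_trans.
have [D D0 DP] := bounded_edist cK (compact_set1 (x := p0)).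
have approx N y : K y -> exists2 p, P p & edist y p <= D * rho ^+ N.
  elim: N y => [|N IH] y Ky.
    by exists p0 => //; rewrite expr0 mulr1; exact: DP.
  move: Ky; rewrite {1}KE => -[i _ [z /IH[p Pp zp] <-]].
  exists (S i p); first exact/SP/imageP.
  have /andP[r0 rrho] := r01 i.
  rewrite simS exprS mulrCA; apply: ler_pM => //; exact: edist_ge0.
have [//|nPx] := pselect (P x).
have [|d d0 dP] := separated_compact (compact_set1 (x := x)) cP.
  by rewrite -subset0 => y [->].
suff : d <= 0 by rewrite leNgt d0.
apply: (le_of_geometric (D := D) rho01) => N; rewrite add0r.
by have [p Pp xp] := approx N x Kx; apply: le_trans xp; exact: dP.
Qed.

End Addresses.

(** * Pieces of a polygonal system *)

Section PolygonalSystems.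
Context {R : realType} {m : nat}.
Implicit Types (P : set (plane R)) (S : 'I_m -> plane R -> plane R).

Lemma polygonal_ratios P S : polygonal_tree_system P S ->
  exists r : 'I_m -> R, forall i, 0 < r i < 1 /\ similarity (r i) (S i).
Proof.
move=> [_ simS _ _ _ _].
have ex_ratio i : exists q, 0 < q < 1 /\ similarity q (S i).
  by have [q q01 sq] := simS i; exists q.
by have [r rP] := choice ex_ratio; exists r.
Qed.

Lemma ratio_bound (r : 'I_m -> R) : (forall i, 0 < r i < 1) ->
  exists rho, 0 <= rho < 1 /\ forall i, r i <= rho.
Proof.
move=> r01; have [i|i d e _ ed rd|d d0 dP] :=
    finite_uniform (Q := fun i d => r i <= 1 - d).
- by have /andP[_ r1] := r01 i; exists (1 - r i); rewrite ?subr_gt0// subKr.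
- by apply: le_trans rd _; rewrite lerD2l lerN2.
exists (Num.max 0 (1 - d)); split=> [|i]; last by rewrite le_max dP orbT.
by rewrite le_max lexx /= gt_max ltr01 gtrBl.
Qed.

Lemma polygon_nonempty P : convex_polygon P -> P !=set0.
Proof. by move=> [_ [x /nbhs_singleton Px]]; exists x. Qed.

(** A vertex of a polygon [Q] that lies in a piece [f @` P] of [Q] is extreme in
    the piece as well, hence the image of a vertex of [P]. *)
Lemma piece_vertex P (r : R) (f : plane R -> plane R) (Q : set (plane R)) x :
  0 < r -> similarity r f -> f @` P `<=` Q -> vertices Q x -> (f @` P) x ->
  exists2 p, vertices P p & f p = x.
Proof.
move=> r0 sf fPQ Qx [p Pp px]; exists p => //.
apply: vertex_preimage fPQ Pp _; last by rewrite px.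
- exact: similarity_affine sf.
- exact: similarity_inj r0 sf.
Qed.

Lemma vertices_sub P x : vertices P x -> P x. Proof. by case. Qed.

(** A similarity is affine, so it carries a cone decomposition of [P] to one of
    the piece; the two pieces are then cones with the same apex. *)
Lemma piece_separation P S (r : 'I_m -> R) i j v : polygonal_tree_system P S ->
  (forall i, 0 < r i) -> (forall i, similarity (r i) (S i)) ->
  S i @` P `&` S j @` P = [set v] ->
  vertices (S i @` P) v -> vertices (S j @` P) v ->
  exists2 c, 0 < c & forall p q, P p -> P q ->
    c * edist (S i p) v <= edist (S i p) (S j q).
Proof.
move=> [polP _ _ _ _ _] r0 simS ijv vi vj.
have base k : vertices (S k @` P) v ->
    exists B, [/\ compact B, ~ B v & S k @` P = cone_over v B].
  move=> vk; have [p vp pv] := piece_vertex (r0 k) (simS k)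
    (@subset_refl _ _) vk (vertices_sub vk).
  have [B [cB Bp PE]] := polygon_cone polP vp.
  exists (S k @` B); split.
  - exact: compact_similarity (r0 k) (simS k) cB.
  - move=> [b Bb]; rewrite -pv => /(similarity_inj (r0 k) (simS k)) bp.
    by apply: Bp; rewrite -bp.
  - by rewrite PE image_cone ?pv//; exact: similarity_affine (simS k).
have [B [cB Bv BE]] := base i vi; have [C [cC Cv CE]] := base j vj.
rewrite BE CE in ijv; have [c c0 cP] := cone_separation cB cC Bv Cv ijv.
by exists c => // p q Pp Pq; apply: cP; rewrite -?BE -?CE; exact: imageP.
Qed.

(** The dichotomy of disjoint pieces and pieces in contact, with a single
    constant; [a] and [b] are the preimages of the contact vertex. *)
Lemma uniform_separation P S (r : 'I_m -> R) : polygonal_tree_system P S ->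
  (forall i, 0 < r i) -> (forall i, similarity (r i) (S i)) ->
  exists2 c, 0 < c & forall i j, i != j ->
    (forall p q, P p -> P q -> c <= edist (S i p) (S j q)) \/
    exists a b, [/\ vertices P a, vertices P b, S i a = S j b &
      forall p q, P p -> P q ->
        c * edist (S i p) (S i a) <= edist (S i p) (S j q) /\
        c * edist (S j q) (S j b) <= edist (S i p) (S j q)].
Proof.
move=> sysS r0 simS; have [polP _ _ meetP _ _] := sysS.
have cP := compact_polygon polP.
pose separated (ij : 'I_m * 'I_m) c := ij.1 != ij.2 ->
  (forall p q, P p -> P q -> c <= edist (S ij.1 p) (S ij.2 q)) \/
  exists a b, [/\ vertices P a, vertices P b, S ij.1 a = S ij.2 b &
    forall p q, P p -> P q ->
      c * edist (S ij.1 p) (S ij.1 a) <= edist (S ij.1 p) (S ij.2 q) /\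
      c * edist (S ij.2 q) (S ij.2 b) <= edist (S ij.1 p) (S ij.2 q)].
have [[i j]|[i j] c d _ dc cP2|c c0 cP2] := finite_uniform (Q := separated).
- have [->|nij] := eqVneq i j; first by exists 1; rewrite /separated /= ?eqxx.
  have [ij0|[v [ijv vi vj]]] := meetP _ _ nij.
    have [c c0 cP2] := separated_compact
      (compact_similarity (r0 i) (simS i) cP)
      (compact_similarity (r0 j) (simS j) cP) ij0.
    by exists c => // _; left => p q Pp Pq; apply: cP2; exact: imageP.
  have [a va av] := piece_vertex (r0 i) (simS i) (@subset_refl _ _)
    vi (vertices_sub vi).
  have [b vb bv] := piece_vertex (r0 j) (simS j) (@subset_refl _ _)
    vj (vertices_sub vj).
  have [c c0 cP2] := piece_separation sysS r0 simS ijv vi vj.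
  rewrite setIC in ijv.
  have [d d0 dP2] := piece_separation sysS r0 simS ijv vj vi.
  exists (Num.min c d) => [|_]; first by rewrite lt_min c0.
  right; exists a, b; split; rewrite ?av ?bv// => p q Pp Pq; split.
    apply: le_trans (cP2 p q Pp Pq).
    by rewrite ler_wpM2r ?edist_ge0// ge_min lexx.
  rewrite (edistC (S i p)); apply: le_trans (dP2 q p Pq Pp).
  by rewrite ler_wpM2r ?edist_ge0// ge_min lexx orbT.
- move=> nij; have [far|[a [b [va vb ab near]]]] := cP2 nij.
    by left => p q Pp Pq; apply: le_trans dc _; exact: far.
  right; exists a, b; split => // p q Pp Pq; have [c1 c2] := near p q Pp Pq.
  by split; [apply: le_trans c1|apply: le_trans c2]; rewrite ler_wpM2r ?edist_ge0.
by exists c => // i j; exact: (cP2 (i, j)).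
Qed.

End PolygonalSystems.

(** * The Hölder estimate for points with a common address *)

Section HolderEstimate.
Context {R : realType} {m n : nat}.
Variables (P P' : set (plane R)) (S S' : 'I_m -> plane R -> plane R).
Variables (A A' : 'I_n -> plane R) (r r' : 'I_m -> R) (alpha : R).
(* Of the relation of sharing an address, only the inclusion in [P * P'] and the
   removal of the first index matter here. *)
Variable G : plane R -> plane R -> Prop.

Hypothesis sysS : polygonal_tree_system P S.
Hypothesis polP' : convex_polygon P'.
Hypothesis ratioS : forall i, 0 < r i < 1 /\ similarity (r i) (S i).
Hypothesis ratioS' : forall i, 0 < r' i < 1 /\ similarity (r' i) (S' i).
Hypothesis vertA : set_bij setT (vertices P) A.
Hypothesis vertA' : set_bij setT (vertices P') A'.
Hypothesis alpha01 : 0 < alpha <= 1.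
Hypothesis r'_le : forall i, r' i <= r i `^ alpha.
Hypothesis vertex_cond : forall i j k, S k (A i) = A j -> S' k (A' i) = A' j.
Hypothesis contact_cond : forall i j k1 k2,
  S k1 (A i) = S k2 (A j) -> S' k1 (A' i) = S' k2 (A' j).
Hypothesis G_sub : forall x x', G x x' -> P x /\ P' x'.
Hypothesis G_uncons : forall x x', G x x' ->
  exists i y y', [/\ x = S i y, x' = S' i y' & G y y'].

Let r_gt0 i : 0 < r i. Proof. by have [/andP[]] := ratioS i. Qed.
Let simS i : similarity (r i) (S i). Proof. by have [] := ratioS i. Qed.
Let simS' i : similarity (r' i) (S' i). Proof. by have [] := ratioS' i. Qed.
Let vA a : vertices P (A a). Proof. by case: vertA => + _ _; apply. Qed.
Let vA' a : vertices P' (A' a). Proof. by case: vertA' => + _ _; apply. Qed.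

Let vertex_index p : vertices P p -> exists a, A a = p.
Proof. by case: vertA => _ _ + /[dup] => /[apply] -[a _ <-]; exists a. Qed.

Let powR_mono (u v : R) : 0 <= u -> u <= v -> u `^ alpha <= v `^ alpha.
Proof.
move=> u0 uv; have [a0 _] := andP alpha01.
by apply: ge0_ler_powR => //; rewrite ?nnegrE ?(le_trans u0 uv)// ltW.
Qed.

(** Since [r' <= r ^ alpha], the estimate is stable under a common map, with the
    same constant and a smaller error. *)
Lemma holder_step (C E rho : R) i z w z' w' : 0 <= C -> 0 <= E -> r' i <= rho ->
  edist z' w' <= C * edist z w `^ alpha + E ->
  edist (S' i z') (S' i w') <= C * edist (S i z) (S i w) `^ alpha + E * rho.
Proof.
move=> C0 E0 r'rho zw; rewrite simS simS' (powRM _ (ltW (r_gt0 i)) (edist_ge0 _ _)).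
have r'0 : 0 <= r' i by have [/andP[/ltW]] := ratioS' i.
apply: (le_trans (ler_wpM2l r'0 zw)); rewrite mulrDr mulrCA.
apply: lerD; last by rewrite mulrC ler_wpM2l.
by rewrite ler_wpM2l// ler_wpM2r// powR_ge0.
Qed.

(** As long as the piece containing [z] contains the vertex, a common map is
    removed; otherwise [z] is at distance at least [d] from it, and the diameter
    [D] of [P'] gives the constant. *)
Lemma vertex_estimate : exists2 C, 0 < C & forall a z z', G z z' ->
  edist z' (A' a) <= C * edist z (A a) `^ alpha.
Proof.
have [polP _ subP _ _ _] := sysS.
have cP := compact_polygon polP; have cP' := compact_polygon polP'.
have [D D0 DP] := bounded_edist cP' cP'.
have [rho [/andP[rho0 rho1] rhoP]] := ratio_bound (fun i => (ratioS' i).1).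
have [[a i]|[a i] d e _ ed dP|d d0 dP] :=
  finite_uniform (Q := fun (ai : 'I_n * 'I_m) d => ~ (S ai.2 @` P) (A ai.1) ->
    forall p, P p -> d <= edist (S ai.2 p) (A ai.1)).
- have [Aai|nAai] := pselect ((S i @` P) (A a)); first by exists 1.
  have [|d d0 dP] := separated_compact
    (compact_similarity (r_gt0 i) (simS i) cP) (compact_set1 (x := A a)).
    by rewrite -subset0 => x [Px xA]; apply: nAai; rewrite -xA.
  by exists d => // _ p Pp; apply: dP => //; exact: imageP.
- by move=> na p Pp; apply: le_trans ed _; exact: dP.
exists (D / d `^ alpha) => [|a z z']; first by rewrite divr_gt0// powR_gt0.
set C := D / _.
have C0 : 0 <= C by rewrite divr_ge0 ?powR_ge0// ltW.
move=> Gz; apply: (le_of_geometric (D := D) (rho := rho)); first by rewrite rho0.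
move=> N; elim: N a z z' Gz => [|N IH] a z z' Gz.
  rewrite expr0 mulr1; apply: ler_wpDl; first exact: mulr_ge0 C0 (powR_ge0 _ _).
  by apply: DP; [have [] := G_sub Gz|case: (vA' a)].
have [i [y [y' [-> z'E Gy]]]] := G_uncons Gz.
have [Py _] := G_sub Gy.
have [Ai|nAi] := pselect ((S i @` P) (A a)).
  have [p vp pA] := piece_vertex (r_gt0 i) (simS i) (subP i) (vA a) Ai.
  have [b bp] := vertex_index vp; rewrite -bp in pA.
  rewrite z'E -(vertex_cond pA) -pA exprSr mulrA.
  apply: holder_step => //; last exact: IH.
  by rewrite mulr_ge0 ?exprn_ge0// ltW.
have dz : d <= edist (S i y) (A a) by exact: (dP (a, i)).
apply: (@le_trans _ _ (C * d `^ alpha)).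
  rewrite /C divfK; last by rewrite gt_eqF// powR_gt0.
  by apply: DP; [have [] := G_sub Gz|case: (vA' a)].
apply: ler_wpDr; first by rewrite mulr_ge0 ?exprn_ge0// ltW.
by rewrite ler_wpM2l// powR_mono// ltW.
Qed.

(** Once the common maps are removed, the points lie in different pieces, and
    the path from [x'] to [y'] through the common vertex is controlled by
    [vertex_estimate] at both ends. *)
Lemma holder_estimate : exists2 C, 0 < C & forall x x' y y', G x x' -> G y y' ->
  edist x' y' <= C * edist x y `^ alpha.
Proof.
have cP' := compact_polygon polP'.
have [D D0 DP] := bounded_edist cP' cP'.
have [rho [/andP[rho0 rho1] rhoP]] := ratio_bound (fun i => (ratioS' i).1).
have [E E0 EP] := vertex_estimate.
have [c c0 sepP] := uniform_separation sysS r_gt0 simS.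
have ca0 : 0 < c `^ alpha by rewrite powR_gt0.
(* [D] pays for disjoint pieces, [2 * E] for the two legs through a contact
   vertex. *)
exists ((D + 2 * E) / c `^ alpha) => [|x x' y y'].
  by rewrite divr_gt0// addr_gt0// mulr_gt0.
set C := _ / _.
have C0 : 0 <= C by rewrite divr_ge0 ?ltW// addr_gt0// mulr_gt0.
move=> Gx Gy; apply: (le_of_geometric (D := D) (rho := rho)); first by rewrite rho0.
move=> N; elim: N x x' y y' Gx Gy => [|N IH] x x' y y' Gx Gy.
  rewrite expr0 mulr1; apply: ler_wpDl; first exact: mulr_ge0 C0 (powR_ge0 _ _).
  by apply: DP; [have [] := G_sub Gx|have [] := G_sub Gy].
have [[_ P'x] [_ P'y]] := (G_sub Gx, G_sub Gy).
have [i [z [z' [xE x'E Gz]]]] := G_uncons Gx.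
have [j [w [w' [yE y'E Gw]]]] := G_uncons Gy.
have [[Pz _] [Pw _]] := (G_sub Gz, G_sub Gw).
have [ij|nij] := eqVneq i j.
  rewrite xE x'E yE y'E -ij exprSr mulrA; apply: holder_step => //; last exact: IH.
  by rewrite mulr_ge0 ?exprn_ge0// ltW.
apply: ler_wpDr; first by rewrite mulr_ge0 ?exprn_ge0// ltW.
rewrite /C mulrAC ler_pdivlMr//.
have [far|[p [q [vp vq pq near]]]] := sepP i j nij.
  have dz : c <= edist x y by rewrite xE yE; exact: far.
  apply: ler_pM; rewrite ?edist_ge0 ?powR_ge0//; last by rewrite powR_mono// ltW.
  by apply: (le_trans (DP _ _ P'x P'y)); rewrite lerDl mulr_ge0// ltW.
have [a ap] := vertex_index vp; have [b bq] := vertex_index vq.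
rewrite -ap -bq in pq near.
(* One leg of the path, from a point to the contact vertex. *)
have to_v k u u' d : G u u' -> c * edist (S k u) (S k (A d)) <= edist x y ->
    edist (S' k u') (S' k (A' d)) * c `^ alpha <= E * edist x y `^ alpha.
  move=> Gu cu; have h : edist (S' k u') (S' k (A' d)) <=
      E * edist (S k u) (S k (A d)) `^ alpha + 0 * rho.
    by apply: holder_step => //; rewrite ?addr0 ?(ltW E0)//; exact: EP.
  rewrite mul0r addr0 in h.
  apply: (@le_trans _ _ (E * edist (S k u) (S k (A d)) `^ alpha * c `^ alpha)).
    by rewrite ler_wpM2r// ltW.
  rewrite -mulrA -powRM ?edist_ge0 ?(ltW c0)// ler_wpM2l ?(ltW E0)//.
  by rewrite powR_mono ?mulr_ge0 ?edist_ge0 ?(ltW c0)// mulrC.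
have [nz nw] := near z w Pz Pw.
rewrite {}xE {}yE in to_v *; rewrite x'E y'E.
have hz := to_v i z z' a Gz nz; have hw := to_v j w w' b Gw nw.
apply: (@le_trans _ _ ((edist (S' i z') (S' i (A' a)) +
    edist (S' j w') (S' j (A' b))) * c `^ alpha)).
  rewrite ler_wpM2r ?(ltW ca0)//; apply: (le_trans (edist_triangle _ (S' i (A' a)) _)).
  by rewrite lerD2l edistC (contact_cond pq).
rewrite mulrDl; apply: (le_trans (lerD hz hw)).
rewrite -mulrDl ler_wpM2r ?powR_ge0//; have := ltW D0; lra.
Qed.

End HolderEstimate.

(** * The conjugacy *)

Lemma holder_continuous (R : realType) (X : set (plane R)) f :
  holder_on X f -> {within X, continuous f}.
Proof.
move=> [C [a [C0 /andP[a0 _] fP]]]; apply/subspace_continuousP => x Xx U.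
move=> /near_edist[e e0 eU].
have d0 : 0 < (e / C) `^ a^-1 by rewrite powR_gt0// divr_gt0.
have : \forall y \near x, edist x y < (e / C) `^ a^-1 by exact: edist_lt_near.
apply: filterS => y xy Xy; apply: eU; apply: (le_lt_trans (fP _ _ Xx Xy)).
rewrite mulrC -ltr_pdivlMr//.
have -> : e / C = ((e / C) `^ a^-1) `^ a.
  by rewrite -powRrM mulVf ?gt_eqF// powRr1// divr_ge0 ?ltW.
by apply: gt0_ltr_powR => //; rewrite nnegrE ?edist_ge0// ltW.
Qed.

Lemma same_address_holder (R : realType) (m n : nat)
    (P P' : set (plane R)) (S S' : 'I_m -> plane R -> plane R)
    (A A' : 'I_n -> plane R) (K K' : set (plane R)) :
  polygonal_tree_system P S -> polygonal_tree_system P' S' ->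
  attractor S K -> attractor S' K' ->
  set_bij setT (vertices P) A -> set_bij setT (vertices P') A' ->
  (forall i j k, S k (A i) = A j -> S' k (A' i) = A' j) ->
  (forall i j k1 k2, S k1 (A i) = S k2 (A j) -> S' k1 (A' i) = S' k2 (A' j)) ->
  exists C alpha : R, [/\ 0 < C, 0 < alpha <= 1 &
    forall x x' y y', same_address S S' K K' x x' ->
      same_address S S' K K' y y' ->
      edist x' y' <= C * edist x y `^ alpha].
Proof.
move=> sysS sysS' SK SK' vA vA' cond1 cond2.
have [r rP] := polygonal_ratios sysS.
have [r' r'P] := polygonal_ratios sysS'.
have [alpha alpha01 r'r] :=
  holder_exponent (fun i => (rP i).1) (fun i => (r'P i).1).
have sub Q (T : 'I_m -> plane R -> plane R) L q : polygonal_tree_system Q T ->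
    (forall i, 0 < q i < 1 /\ similarity (q i) (T i)) -> attractor T L ->
    L `<=` Q.
  move=> [polQ _ subQ _ _ _] qP TL.
  have [rho [/andP[rho0 rho1] rhoP]] := ratio_bound (fun i => (qP i).1).
  apply: (attractor_sub (r := q) (rho := rho)) => //.
  - by move=> i; have [] := qP i.
  - by move=> i; have [/andP[q0 _] _] := qP i; rewrite ltW /=.
  - exact: polygon_nonempty.
  - exact: compact_polygon.
have inj (T : 'I_m -> plane R -> plane R) q :
    (forall i, 0 < q i < 1 /\ similarity (q i) (T i)) -> forall i, injective (T i).
  by move=> qP i; have [/andP[q0 _] sq] := qP i; exact: similarity_inj q0 sq.
have [|x x'|x x'|C C0 CP] := holder_estimate (G := same_address S S' K K')
  sysS _ rP r'P vA vA' alpha01 r'r cond1 cond2.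
- by case: sysS'.
- move=> h; have [Kx Kx'] := same_address_attractor h.
  by split; [exact: sub sysS rP SK _ Kx|exact: sub sysS' r'P SK' _ Kx'].
- by apply: same_address_uncons; [exact: inj rP|exact: inj r'P].
by exists C, alpha.
Qed.

Unset Implicit Arguments.

Theorem theorem26 (R : realType) (m n : nat)
    (P P' : set (plane R)) (S S' : 'I_m -> plane R -> plane R)
    (A A' : 'I_n -> plane R) (K K' : set (plane R)) :
  polygonal_tree_system P S ->
  polygonal_tree_system P' S' ->
  attractor S K ->
  attractor S' K' ->
  set_bij setT (vertices P) A ->
  set_bij setT (vertices P') A' ->
  (forall (i j : 'I_n) (k : 'I_m), S k (A i) = A j <-> S' k (A' i) = A' j) ->
  (forall (i j : 'I_n) (k1 k2 : 'I_m),
     S k1 (A i) = S k2 (A j) <-> S' k1 (A' i) = S' k2 (A' j)) ->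
  exists psi : plane R -> plane R,
    bi_holder_homeomorphism K K' psi /\
    forall (i : 'I_m) (x : plane R), K x -> psi (S i x) = S' i (psi x).
Proof.
move=> sysS sysS' SK SK' vA vA' cond1 cond2.
have [C [a [C0 a01 CP]]] := same_address_holder
  sysS sysS' SK SK' vA vA' (fun i j k => (cond1 i j k).1)
  (fun i j k l => (cond2 i j k l).1).
have [C' [a' [C'0 a'01 C'P]]] := same_address_holder
  sysS' sysS SK' SK vA' vA (fun i j k => (cond1 i j k).2)
  (fun i j k l => (cond2 i j k l).2).
have cont Q T : polygonal_tree_system Q T -> forall i : 'I_m, continuous (T i).
  move=> /polygonal_ratios[r rP] i; have [/andP[r0 _] sr] := rP i.
  exact: continuous_similarity r0 sr.
have total T T' L L' : (forall i, continuous (T' i)) ->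
    attractor T L -> attractor T' L' ->
    exists f, forall x, L x -> @same_address R m T T' L L' x (f x).
  move=> cT' TL TL'.
  have ex x : exists x', L x -> same_address T T' L L' x x'.
    have [Lx|nLx] := pselect (L x); last by exists x.
    by have [x' x'P] := same_address_total cT' TL TL' Lx; exists x'.
  by have [f fP] := choice ex; exists f.
have [psi psiP] := total _ _ _ _ (cont _ _ _ sysS') SK SK'.
have [phi phiP] := total _ _ _ _ (cont _ _ _ sysS) SK' SK.
(* Points sharing the address of a single point are at distance [0 ^ b = 0]. *)
have unique T T' L L' B b x x' x'' : 0 < b <= 1 ->
    (forall x x' y y', @same_address R m T T' L L' x x' ->
      same_address T T' L L' y y' -> edist x' y' <= B * edist x y `^ b) ->
    same_address T T' L L' x x' -> same_address T T' L L' x x'' -> x' = x''.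
  move=> /andP[b0 _] BP xx' xx''; apply: edist_eq0; apply/le_anti.
  rewrite edist_ge0 andbT; apply: (le_trans (BP _ _ _ _ xx' xx'')).
  by rewrite edistxx powR0 ?gt_eqF// mulr0.
have holpsi : holder_on K psi.
  by exists C, a; split => // x y Kx Ky; apply: CP; exact: psiP.
have holphi : holder_on K' phi.
  by exists C', a'; split => // x y Kx Ky; apply: C'P; exact: phiP.
have Kpsi x : K x -> K' (psi x).
  by move=> Kx; have [] := same_address_attractor (psiP x Kx).
have Kphi x : K' x -> K (phi x).
  by move=> Kx; have [] := same_address_attractor (phiP x Kx).
exists psi; split; last first.
  move=> i x Kx; apply: (unique S S' K K' C a (S i x)) => //.
  - by apply: psiP; exact: attractor_piece SK Kx.
  - by apply: same_address_cons => //; exact: psiP.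
exists phi; split => //; try exact: holder_continuous.
split => // x; rewrite inE => Kx.
- apply: (unique S' S K' K C' a' (psi x)) => //; first exact/phiP/Kpsi.
  exact/same_addressC/psiP.
- apply: (unique S S' K K' C a (phi x)) => //; first exact/psiP/Kphi.
  exact/same_addressC/phiP.
Qed.
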